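(* Let $\boldsymbol{\mathcal A},\boldsymbol{\mathcal B}$ be positive deformations of $^*$-algebras $\mathcal A,\mathcal B$ over $\mathsf C$ with approximate identities, and let $\boldsymbol{\mathfrak X}$ be a $(\boldsymbol{\mathcal B}$-$\boldsymbol{\mathcal A})$-equivalence bimodule (where instead of X6 and Y6 only tX6 and tY6 need to be satisfied). If the classical limit $\mathfrak X=\boldsymbol{\mathfrak X}/\boldsymbol{\mathfrak X}_L$ satisfies P and Q, then $\mathfrak X$ is a $(\mathcal B$-$\mathcal A)$-equivalence bimodule. If $\boldsymbol{\mathfrak X}$ satisfies in addition P1--P3 and Q1--Q3, then the classical limit is automatically an equivalence bimodule also satisfying P1--P3 and Q1--Q3.
   Context: $\mathsf R$ is an ordered ring (commutative ring with $1\ne0$ and a subset $\mathsf P$ closed under sums and products such that $\mathsf R$ is the disjoint union $-\mathsf P\cup\{0\}\cup\mathsf P$), and $\mathsf C=\mathsf R(\mathrm i)$ with $\mathrm i^2=-1$ and the usual conjugation. $\mathsf R[[\lambda]]$ is an ordered ring: a non-zero $a=\sum_{r\ge r_0}\lambda^ra_r$ with $a_{r_0}\ne0$ is positive iff $a_{r_0}>0$; $\mathsf C[[\lambda]]=\mathsf R[[\lambda]](\mathrm i)$. $\mathfrak C$ applied to a formal power series is its zeroth order term. A $^*$-algebra over $\mathsf C$ is an associative (not necessarily unital) $\mathsf C$-algebra with an antilinear involution satisfying $(AB)^*=B^*A^*$. A linear functional $\omega$ is positive if $\omega(A^*A)\ge0$ for all $A$; a Hermitian $A$ satisfies $A\ge0$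 if $\omega(A)\ge0$ for all positive linear functionals. A $^*$-algebra deformation of $\mathcal A$ is $\boldsymbol{\mathcal A}=\mathcal A[[\lambda]]$ with a $\mathsf C[[\lambda]]$-bilinear associative product $\mu=\sum_r\lambda^r\mu_r$ and a $^*$-involution $I=\sum_r\lambda^rI_r$ for $\mu$ such that $\mu_0,I_0$ are the given product and involution of $\mathcal A$. It is a positive deformation if every positive $\mathsf C$-linear functional of $\mathcal A$ is the zeroth order term of some positive $\mathsf C[[\lambda]]$-linear functional of $\boldsymbol{\mathcal A}$. An approximate identity of $\mathcal A$ is a family $\{\mathcal A_\alpha,E_\alpha\}_{\alpha\in I}$, $I$ directed, with $E_\alpha=E_\alpha^*\in\mathcal A$, $E_\alpha=E_\alpha E_\beta=E_\beta E_\alpha$ for $\alpha<\beta$, submodules $\mathcal A_\alpha\subseteq\mathcal A_\beta$ for $\alpha\le\beta$, $\bigcup_\alpha\mathcal A_\alpha=\mathcal A$, and $E_\alpha A=A=AE_\alpha$ for $A\in\mathcal A_\alpha$. A pre-Hilbert space is a module over the scalars with a Hermitian inner product (linear in the second argument), $\langle\phi,\phi\rangle\ge0$, and $\langle\phi,\phi\rangle=0\Rightarrow\phi=0$. A $^*$-representation is a $^*$-homomorphism into the adjointable endomorphisms of a pre-Hilbert space. The following is used over $\mathsf C$ for $(\mathcal A,\mathcal B)$ and over $\mathsf C[[\lambda]]$ for $(\boldsymbol{\mathcal A},\boldsymbol{\mathcal B})$. A $(\mathcal B$-$\mathcal A)$-equivalence bimodule is a module $\mathfrak X$ with commuting left $\mathcal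 B$- and right $\mathcal A$-actions and maps $\langle\cdot,\cdot\rangle_{\mathcal A}:\mathfrak X\times\mathfrak X\to\mathcal A$, ${}_{\mathcal B}\langle\cdot,\cdot\rangle:\mathfrak X\times\mathfrak X\to\mathcal B$ such that: E1) X1) $\langle\cdot,\cdot\rangle_{\mathcal A}$ is linear in the second argument; X2) $\langle x,y\rangle_{\mathcal A}=\langle y,x\rangle_{\mathcal A}^*$; X3) $\langle x,y\cdot A\rangle_{\mathcal A}=\langle x,y\rangle_{\mathcal A}A$; X4) $\langle x,x\rangle_{\mathcal A}\ge0$; X5) $\langle x,B\cdot y\rangle_{\mathcal A}=\langle B^*\cdot x,y\rangle_{\mathcal A}$; X6) the linear span of all $\langle x,y\rangle_{\mathcal A}$ is $\mathcal A$. E2) Y1) ${}_{\mathcal B}\langle\cdot,\cdot\rangle$ is linear in the first argument; Y2) ${}_{\mathcal B}\langle x,y\rangle={}_{\mathcal B}\langle y,x\rangle^*$; Y3) ${}_{\mathcal B}\langle B\cdot x,y\rangle=B\,{}_{\mathcal B}\langle x,y\rangle$; Y4) ${}_{\mathcal B}\langle x,x\rangle\ge0$; Y5) ${}_{\mathcal B}\langle x\cdot A,y\rangle={}_{\mathcal B}\langle x,y\cdot A^*\rangle$; Y6) the linear span of all ${}_{\mathcal B}\langle x,y\rangle$ is $\mathcal B$. E3) ${}_{\mathcal B}\langle x,y\rangle\cdot z=x\cdot\langle y,z\rangle_{\mathcal A}$. E4) P): for every $^*$-representation $(\mathfrak H,\pi)$ of $\mathcal A$ the form $\langle x\otimes\psi,y\otimes\phi\rangle=\langle\psi,\pi(\langle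 x,y\rangle_{\mathcal A})\phi\rangle$ on $\mathfrak X\otimes_{\mathcal A}\mathfrak H$ is positive semi-definite; and Q): P holds for the conjugate $(\mathcal A$-$\mathcal B)$-bimodule $\overline{\mathfrak X}$ (conjugate module, $A\bar x=\overline{xA^*}$, $\bar xB=\overline{B^*x}$) with $\langle\bar x,\bar y\rangle_{\mathcal B}={}_{\mathcal B}\langle x,y\rangle$. tX6), tY6): for $\boldsymbol{\mathfrak X}$, the spans in X6, Y6 are only required to be dense in $\mathcal A[[\lambda]]$, $\mathcal B[[\lambda]]$ in the $\lambda$-adic topology. P1) $\mathfrak X=\bigoplus_i\mathfrak X^{(i)}$ with $\mathfrak X^{(i)}\perp\mathfrak X^{(j)}$ for $i\ne j$ with respect to $\langle\cdot,\cdot\rangle_{\mathcal A}$. P2) The right $\mathcal A$-action preserves this direct sum. P3) Each $\mathfrak X^{(i)}$ is a union $\bigcup_\alpha\mathfrak X^{(i)}_\alpha$ of submodules indexed by a directed set, $\mathfrak X^{(i)}_\alpha\subseteq\mathfrak X^{(i)}_\beta$ for $\alpha\le\beta$, with $\Omega^{(i)}_\alpha\in\mathfrak X^{(i)}_\alpha$ such that every $x\in\mathfrak X^{(i)}_\alpha$ is of the form $\Omega^{(i)}_\alpha\cdot A$. Q1--Q3: the analogous conditions (independent decomposition) for ${}_{\mathcal B}\langle\cdot,\cdot\rangle$ and the left $\mathcal B$-action. Classical limit: $\boldsymbol{\mathfrak X}_L=\{\boldsymbol x\mid\mathfrak C\langle\boldsymbol x,\boldsymbol y\rangle_{\boldsymbol{\mathcal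 A}}=0\ \forall\boldsymbol y\}$, which in this situation equals $\{\boldsymbol x\mid\mathfrak C\,{}_{\boldsymbol{\mathcal B}}\langle\boldsymbol x,\boldsymbol y\rangle=0\ \forall\boldsymbol y\}$; $\mathfrak X=\boldsymbol{\mathfrak X}/\boldsymbol{\mathfrak X}_L$ as a $\mathsf C$-module, with class map $\boldsymbol x\mapsto\mathfrak C\boldsymbol x$, actions $B\cdot\mathfrak C\boldsymbol x=\mathfrak C(B\cdot\boldsymbol x)$, $\mathfrak C\boldsymbol x\cdot A=\mathfrak C(\boldsymbol x\cdot A)$ for $A\in\mathcal A,B\in\mathcal B$, and inner products $\langle\mathfrak C\boldsymbol x,\mathfrak C\boldsymbol y\rangle_{\mathcal A}=\mathfrak C\langle\boldsymbol x,\boldsymbol y\rangle_{\boldsymbol{\mathcal A}}$, ${}_{\mathcal B}\langle\mathfrak C\boldsymbol x,\mathfrak C\boldsymbol y\rangle=\mathfrak C\,{}_{\boldsymbol{\mathcal B}}\langle\boldsymbol x,\boldsymbol y\rangle$. *)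

(* Defs.v *)
From HB Require Import structures.
From mathcomp Require Import all_boot all_order all_algebra.
From mathcomp Require Import boolp classical_sets.

Set Implicit Arguments.
Unset Strict Implicit.
Unset Printing Implicit Defensive.

Import Order.TTheory GRing.Theory Num.Theory.
Local Open Scope ring_scope.
Local Open Scope quotient_scope.

(* [complex R] of mathcomp-real-closed is a ring only over a field, hence the
   type below, which makes sense over any commutative ring. *)
Record cplx (R : Type) := Cplx { re : R; im : R }.

Section CplxRing.
Variable R : comNzRingType.
Local Notation C := (cplx R).

Definition cplx_pair (z : C) := (re z, im z).
Definition pair_cplx (p : R * R) : C := Cplx p.1 p.2.
Lemma cplx_pairK : cancel cplx_pair pair_cplx. Proof. by case. Qed.
HB.instance Definition _ := Choice.copy C (can_type cplx_pairK).

Definition addc (z w : C) := Cplx (re z + re w) (im z + im w).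
Definition oppc (z : C) := Cplx (- re z) (- im z).
Definition mulc (z w : C) :=
  Cplx (re z * re w - im z * im w) (re z * im w + im z * re w).

Lemma cplxP (z w : C) : re z = re w -> im z = im w -> z = w.
Proof. by case: z w => [a b] [c d] /= -> ->. Qed.

Fact addcA : associative addc.
Proof. by move=> x y z; apply: cplxP; rewrite /= addrA. Qed.
Fact addcC : commutative addc.
Proof. by move=> x y; apply: cplxP; rewrite /= addrC. Qed.
Fact add0c : left_id (Cplx 0 0) addc.
Proof. by move=> x; apply: cplxP; rewrite /= add0r. Qed.
Fact addNc : left_inverse (Cplx 0 0) oppc addc.
Proof. by move=> x; apply: cplxP; rewrite /= addNr. Qed.
HB.instance Definition _ := GRing.isZmodule.Build C addcA addcC add0c addNc.

Fact mulcC : commutative mulc.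
Proof.
by move=> x y; apply: cplxP => /=; rewrite ?[re y * _]mulrC ?[im y * _]mulrC // addrC.
Qed.
Fact mulcA : associative mulc.
Proof.
move=> x y z; apply: cplxP; rewrite /= !(mulrDr, mulrDl, mulrN, mulNr, opprD, mulrA);
  rewrite -!addrA; congr (_ + _); first by rewrite [RHS]addrC !addrA.
by rewrite [RHS]addrC !addrA.
Qed.
Fact mul1c : left_id (Cplx 1 0) mulc.
Proof. by move=> x; apply: cplxP; rewrite /= !mul1r !mul0r ?subr0 ?addr0. Qed.
Fact mulcDl : left_distributive mulc addc.
Proof.
move=> x y z; apply: cplxP; rewrite /= !mulrDl ?opprD -!addrA; congr (_ + _);
  by rewrite addrCA.
Qed.
Fact nonzero1c : Cplx 1 0 != 0 :> C.
Proof. by apply/eqP => -[] /eqP; rewrite oner_eq0. Qed.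
HB.instance Definition _ :=
  GRing.Zmodule_isComNzRing.Build C mulcA mulcC mul1c mulcDl nonzero1c.

Definition conjc (z : C) : C := Cplx (re z) (- im z).

Lemma conjcK : involutive conjc.
Proof. by move=> z; apply: cplxP; rewrite //= opprK. Qed.
Lemma conjcD z w : conjc (z + w) = conjc z + conjc w.
Proof. by apply: cplxP; rewrite //= opprD. Qed.
Lemma conjcM z w : conjc (z * w) = conjc z * conjc w.
Proof. by apply: cplxP; rewrite /= ?mulrNN // mulrN mulNr opprD. Qed.
Lemma conjc1 : conjc 1 = 1.
Proof. by apply: cplxP; rewrite //= oppr0. Qed.
Lemma conjc0 : conjc 0 = 0.
Proof. by apply: cplxP; rewrite //= oppr0. Qed.

End CplxRing.

(* As in [algC], [z >= 0] means that [z] is real and non-negative. *)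
Definition nonnegc (R : realDomainType) (z : cplx R) : Prop :=
  im z = 0 /\ 0 <= re z.

Definition fps (V : Type) := nat -> V.

HB.instance Definition _ (V : Type) := gen_eqMixin (fps V).
HB.instance Definition _ (V : Type) := gen_choiceMixin (fps V).

Section FpsZmod.
Variable V : zmodType.

Definition addf (u v : fps V) : fps V := fun n => u n + v n.
Definition oppf (u : fps V) : fps V := fun n => - u n.
Definition zerof : fps V := fun=> 0.

Fact addfA : associative addf.
Proof. by move=> x y z; apply: funext => n; rewrite /addf addrA. Qed.
Fact addfC : commutative addf.
Proof. by move=> x y; apply: funext => n; rewrite /addf addrC. Qed.
Fact add0f : left_id zerof addf.
Proof. by move=> x; apply: funext => n; rewrite /addf add0r. Qed.
Fact addNf : left_inverse zerof oppf addf.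
Proof. by move=> x; apply: funext => n; rewrite /addf addNr. Qed.
HB.instance Definition _ := GRing.isZmodule.Build (fps V) addfA addfC add0f addNf.

Lemma fpsD (u v : fps V) n : (u + v) n = u n + v n. Proof. by []. Qed.
Lemma fpsN (u : fps V) n : (- u) n = - u n. Proof. by []. Qed.
Lemma fps0 n : (0 : fps V) n = 0. Proof. by []. Qed.
Lemma fpsB (u v : fps V) n : (u - v) n = u n - v n. Proof. by []. Qed.
Lemma fps_sum I (r : seq I) (F : I -> fps V) n :
  (\sum_(i <- r) F i) n = \sum_(i <- r) F i n.
Proof. by elim/big_rec2: _ => // i x y _ <-. Qed.

Definition cst (v : V) : fps V := fun n => if n is 0 then v else 0.

Lemma cstD u v : cst (u + v) = cst u + cst v.
Proof. by apply: funext => -[|n]; rewrite fpsD //= addr0. Qed.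
Lemma cst0 : cst 0 = 0.
Proof. by apply: funext => -[|n]. Qed.

End FpsZmod.

Definition cauchy (U V : Type) (W : zmodType) (op : U -> V -> W)
    (u : fps U) (v : fps V) : fps W :=
  fun n => \sum_(i < n.+1) op (u i) (v (n - i)%N).

Lemma sum_triangle (W : zmodType) (F : nat -> nat -> nat -> W) n :
  \sum_(m < n.+1) \sum_(i < m.+1) F i (m - i)%N (n - m)%N =
  \sum_(i < n.+1) \sum_(j < (n - i).+1) F i j (n - i - j)%N.
Proof.
transitivity (\sum_(m < n.+1) \sum_(i < n.+1 | (i <= m)%N) F i (m - i)%N (n - m)%N).
  apply: eq_bigr => m _; by rewrite (big_ord_widen n.+1 (fun i => F i (m - i)%N (n - m)%N)).
rewrite (exchange_big_dep xpredT) //=; apply: eq_bigr => i _.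
rewrite -(big_mkord (fun m => i <= m)%N (fun m => F i (m - i)%N (n - m)%N)).
rewrite (big_cat_nat (n := i)) //=; last exact: ltnW.
rewrite big_nat_cond big_pred0 ?add0r; last by move=> k /=; case: ltngtP.
rewrite big_nat_cond (eq_bigl (fun m => (i <= m < n.+1) && true)%N); last first.
  by move=> k /=; case: (leqP i k); rewrite ?andbT ?andbF.
rewrite -big_nat_cond -{1}[nat_of_ord i]add0n big_addn big_mkord.
rewrite subSn; last by rewrite -ltnS.
by apply: eq_bigr => j _; rewrite addnK addnC subnDA.
Qed.

Lemma cauchyA (U V W P S Q : zmodType) (op1 : U -> V -> P) (op2 : P -> W -> Q)
    (op3 : V -> W -> S) (op4 : U -> S -> Q) :
  (forall a b c, op2 (op1 a b) c = op4 a (op3 b c)) ->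
  (forall p q c, op2 (p + q) c = op2 p c + op2 q c) ->
  (forall a p q, op4 a (p + q) = op4 a p + op4 a q) ->
  forall u v w, cauchy op2 (cauchy op1 u v) w = cauchy op4 u (cauchy op3 v w).
Proof.
move=> opA op2D op4D u v w; apply: funext => n.
have op20 c : op2 0 c = 0 by apply: (addrI (op2 0 c)); rewrite -op2D !addr0.
have op40 a : op4 a 0 = 0 by apply: (addrI (op4 a 0)); rewrite -op4D !addr0.
transitivity (\sum_(m < n.+1) \sum_(i < m.+1)
    op4 (u i) (op3 (v (m - i)%N) (w (n - m)%N))).
  apply: eq_bigr => m _; rewrite (big_morph (op2^~ _) (fun p q => op2D p q _) (op20 _)).
  by apply: eq_bigr => i _; rewrite opA.
rewrite (sum_triangle (fun i j k => op4 (u i) (op3 (v j) (w k)))).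
by apply: eq_bigr => i _; rewrite -(big_morph _ (op4D _) (op40 _)).
Qed.

Section FpsRing.
Variable R : comNzRingType.

Definition mulf : fps R -> fps R -> fps R := cauchy *%R.

Fact mulfC : commutative mulf.
Proof.
move=> x y; apply: funext => n; rewrite /mulf /cauchy (reindex_inj rev_ord_inj).
by apply: eq_bigr => i _ /=; rewrite subSS subKn ?leq_ord // mulrC.
Qed.
Fact mulfA : associative mulf.
Proof.
move=> x y z; rewrite /mulf; symmetry; apply: cauchyA => *.
- by rewrite mulrA.
- by rewrite mulrDl.
- by rewrite mulrDr.
Qed.
Lemma cauchy_cst (U W : zmodType) (op : R -> U -> W) (a : R) u n :
  (forall u, op 0 u = 0) -> cauchy op (cst a) u n = op a (u n).
Proof.
by move=> op0; rewrite /cauchy big_ord_recl /= subn0 big1 ?addr0 // => i _.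
Qed.
Fact mul1f : left_id (cst 1) mulf.
Proof.
move=> x; apply: funext => n; rewrite /mulf cauchy_cst ?mul1r // => u.
by rewrite mul0r.
Qed.
Fact mulfDl : left_distributive mulf +%R.
Proof.
move=> x y z; apply: funext => n.
by rewrite /mulf /cauchy fpsD -big_split; apply: eq_bigr => i _; rewrite mulrDl.
Qed.
Fact nonzero1f : cst 1 != 0 :> fps R.
Proof. by apply/eqP => /(congr1 (@^~ 0%N)) /eqP; rewrite oner_eq0. Qed.
HB.instance Definition _ :=
  GRing.Zmodule_isComNzRing.Build (fps R) mulfA mulfC mul1f mulfDl nonzero1f.

Lemma fpsM (x y : fps R) n : (x * y) n = \sum_(i < n.+1) x i * y (n - i)%N.
Proof. by []. Qed.


Definition unitf : pred (fps R) := fun x => `[< exists y, y * x = 1 >].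
Definition invf (x : fps R) : fps R :=
  if pselect (exists y, y * x = 1) is left H then xget 0 [set y | y * x = 1] else x.

Fact mulVf : {in unitf, left_inverse 1 invf *%R}.
Proof.
move=> x /asboolP [y yx]; rewrite /invf; case: pselect => [_|[]]; last by exists y.
by case: xgetP => [z _ //|/(_ y)].
Qed.
Fact unitfP (x y : fps R) : y * x = 1 -> unitf x.
Proof. by move=> yx; apply/asboolP; exists y. Qed.
Fact invf_out : {in [predC unitf], invf =1 id}.
Proof.
by move=> x /asboolP xNu; rewrite /invf; case: pselect.
Qed.
HB.instance Definition _ :=
  GRing.ComNzRing_hasMulInverse.Build (fps R) mulVf unitfP invf_out.

End FpsRing.

Section FpsOrder.
Variable R : realDomainType.
Implicit Types x y : fps R.

Lemma fps_neq0 x : x != 0 -> exists2 n, x n != 0 & forall k, (k < n)%N -> x k = 0.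
Proof.
move=> xN0; have ex : exists n, x n != 0.
  apply: contrapT => H; case/eqP: xN0; apply: funext => n; rewrite fps0.
  by apply/eqP/negPn/negP => xn; apply: H; exists n.
case: (ex_minnP ex) => n xn nmin; exists n => // k kn.
by apply/eqP/negPn/negP => /nmin; rewrite leqNgt kn.
Qed.

Lemma fpsM_low x y n m : (forall k, (k < n)%N -> x k = 0) ->
  (forall k, (k < m)%N -> y k = 0) ->
  (forall k, (k < n + m)%N -> (x * y) k = 0) /\ (x * y) (n + m)%N = x n * y m.
Proof.
move=> x0 y0; split=> [k kn|].
  rewrite fpsM big1 // => i _; case: (ltnP i n) => [/x0 ->|ni]; first by rewrite mul0r.
  rewrite y0 ?mulr0 // ltn_subLR ?leq_ord //.
  by apply: leq_trans kn _; rewrite leq_add2r.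
have nlt : (n < (n + m).+1)%N by rewrite ltnS leq_addr.
rewrite fpsM (bigD1 (Ordinal nlt)) //= addKn big1 ?addr0 // => i iN.
case: (ltngtP i n) => [/x0 ->|ni|E]; first by rewrite mul0r.
  by rewrite y0 ?mulr0 // ltn_subLR ?leq_ord // ltn_add2r.
by case/eqP: iN; apply: val_inj.
Qed.

Fact fps_integral : GRing.integral_domain_axiom (fps R).
Proof.
move=> x y xy0; apply/negPn/negP; rewrite negb_or => /andP [].
move=> /fps_neq0 [n xn x0] /fps_neq0 [m ym y0].
have [_] := fpsM_low x0 y0; rewrite xy0 fps0 => /esym/eqP.
by rewrite mulf_eq0 (negPf xn) (negPf ym).
Qed.
HB.instance Definition _ := GRing.ComUnitRing_isIntegral.Build (fps R) fps_integral.

Definition posf (x : fps R) : Prop :=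
  exists2 n, 0 < x n & forall k, (k < n)%N -> x k = 0.
Definition ltf : rel (fps R) := fun x y => `[< posf (y - x) >].
Definition lef : rel (fps R) := fun x y => (x == y) || ltf x y.
Definition normf (x : fps R) : fps R := if ltf x 0 then - x else x.

Lemma ltf0P x : reflect (posf x) (ltf 0 x).
Proof. by rewrite /ltf subr0; apply: asboolP. Qed.

Fact ltf_add x y : ltf 0 x -> ltf 0 y -> ltf 0 (x + y).
Proof.
move=> /ltf0P [n xn x0] /ltf0P [m ym y0]; apply/ltf0P.
case: (ltngtP n m) => [nm|mn|E].
- exists n => [|k kn]; rewrite fpsD; first by rewrite (y0 n nm) addr0.
  by rewrite x0 // y0 ?addr0 // (ltn_trans kn).
- exists m => [|k km]; rewrite fpsD; first by rewrite (x0 m mn) add0r.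
  by rewrite y0 // x0 ?addr0 // (ltn_trans km).
- by subst m; exists n => [|k kn]; rewrite fpsD ?addr_gt0 // x0 // y0 // addr0.
Qed.
Fact ltf_mul x y : ltf 0 x -> ltf 0 y -> ltf 0 (x * y).
Proof.
move=> /ltf0P [n xn x0] /ltf0P [m ym y0]; apply/ltf0P.
by have [H E] := fpsM_low x0 y0; exists (n + m)%N => //; rewrite E mulr_gt0.
Qed.
Fact ltf_ngt0 x : ltf 0 x -> ~~ ltf x 0.
Proof.
move=> /ltf0P [n xn x0]; apply/asboolP => -[m]; rewrite sub0r fpsN oppr_gt0 => xm H.
case: (ltngtP n m) => [nm|mn|E].
- by move: (H _ nm) xn; rewrite fpsN => /eqP; rewrite oppr_eq0 => /eqP ->; rewrite ltxx.
- by move: xm; rewrite x0 // ltxx.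
- by move: xm; rewrite -E => /(lt_trans xn); rewrite ltxx.
Qed.
Fact ltf_sub x y : ltf 0 (y - x) = ltf x y.
Proof. by rewrite /ltf subr0. Qed.
Fact ltf_total x : x != 0 -> ltf 0 x || ltf x 0.
Proof.
case/fps_neq0 => n xn x0; move: xn; rewrite neq_lt => /orP [xn|xn]; apply/orP.
- right; apply/asboolP; exists n => [|k kn]; rewrite sub0r fpsN ?oppr_gt0 //.
  by rewrite x0 ?oppr0.
- by left; apply/ltf0P; exists n.
Qed.
Fact normfN x : normf (- x) = normf x.
Proof.
have N z : ltf (- z) 0 = ltf 0 z by rewrite /ltf sub0r opprK subr0.
rewrite /normf N opprK; case: (boolP (ltf 0 x)) => [/ltf_ngt0/negPf -> //|x0].
case: (boolP (ltf x 0)) => // x0'; have [->|/ltf_total] := eqVneq x 0.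
  by rewrite oppr0.
by rewrite (negPf x0) (negPf x0').
Qed.
Fact normf_ge0 x : lef 0 x -> normf x = x.
Proof.
rewrite /lef /normf => /orP [/eqP <-|/ltf_ngt0/negPf -> //].
by case: ifP; rewrite ?oppr0.
Qed.
HB.instance Definition _ := Num.IntegralDomain_isLtReal.Build (fps R)
  ltf_add ltf_mul ltf_ngt0 ltf_sub ltf_total normfN normf_ge0 (fun _ _ => erefl).

End FpsOrder.


Section FpsModule.
Variable R : realDomainType.

(* The identification of [R[[l]](i)] with [R(i)[[l]]]. *)
Definition coefc (z : cplx (fps R)) : fps (cplx R) := fun n => Cplx (re z n) (im z n).
Definition cstc (z : cplx R) : cplx (fps R) := Cplx (cst (re z)) (cst (im z)).

Lemma coefc_cst z : coefc (cstc z) = cst z.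
Proof. by apply: funext => -[|n] //; case: z. Qed.
Lemma coefcD z w : coefc (z + w) = coefc z + coefc w.
Proof. by []. Qed.
Lemma coefc1 : coefc 1 = cst 1.
Proof. by apply: funext => -[|n]. Qed.
Lemma re_sum I (r : seq I) (F : I -> cplx R) :
  re (\sum_(i <- r) F i) = \sum_(i <- r) re (F i).
Proof. by elim/big_rec2: _ => // i x y _ <-. Qed.
Lemma im_sum I (r : seq I) (F : I -> cplx R) :
  im (\sum_(i <- r) F i) = \sum_(i <- r) im (F i).
Proof. by elim/big_rec2: _ => // i x y _ <-. Qed.
Lemma coefcM z w : coefc (z * w) = coefc z * coefc w.
Proof.
apply: funext => n; apply: cplxP; rewrite fpsM ?re_sum ?im_sum /=.
  by rewrite fpsB !fpsM -sumrB.
by rewrite fpsD !fpsM -big_split.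
Qed.
Lemma coefc_conj z n : coefc (conjc z) n = conjc (coefc z n).
Proof. by []. Qed.

Variable V : lmodType (cplx R).
Implicit Types v : fps V.

Definition scalef (z : cplx (fps R)) v : fps V := cauchy *:%R (coefc z) v.

Fact scalefA z w v : scalef z (scalef w v) = scalef (z * w) v.
Proof.
rewrite /scalef coefcM; symmetry; apply: cauchyA => *.
- by rewrite scalerA.
- by rewrite scalerDl.
- by rewrite scalerDr.
Qed.
Fact scale1f : left_id 1 scalef.
Proof.
move=> v; apply: funext => n; rewrite /scalef coefc1 /cauchy.
by rewrite big_ord_recl /= subn0 scale1r big1 ?addr0 // => i _; rewrite scale0r.
Qed.
Fact scalefDr : right_distributive scalef +%R.
Proof.
move=> z u v; apply: funext => n; rewrite fpsD /scalef /cauchy -big_split.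
by apply: eq_bigr => i _; rewrite fpsD scalerDr.
Qed.
Fact scalefDl v : {morph scalef^~ v : z w / z + w}.
Proof.
move=> z w; apply: funext => n; rewrite fpsD /scalef coefcD /cauchy -big_split.
by apply: eq_bigr => i _; rewrite fpsD scalerDl.
Qed.
HB.instance Definition _ := GRing.Zmodule_isLmodule.Build (cplx (fps R)) (fps V)
  scalefA scale1f scalefDr scalefDl.

Lemma fpsZ (z : cplx (fps R)) v n :
  (z *: v) n = \sum_(i < n.+1) coefc z i *: v (n - i)%N.
Proof. by []. Qed.
Lemma fpsZ0 (z : cplx (fps R)) v : (z *: v) 0%N = coefc z 0 *: v 0%N.
Proof. by rewrite fpsZ big_ord_recl big_ord0 addr0. Qed.
Lemma cstZ (z : cplx R) (v : V) : cst (z *: v) = cstc z *: cst v.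
Proof.
apply: funext => n; rewrite fpsZ coefc_cst big_ord_recl /= subn0 big1 ?addr0.
  by case: n => //= n; rewrite scaler0.
by move=> i _; rewrite scale0r.
Qed.

Definition adically_dense (S : set (fps V)) : Prop :=
  forall v n, exists2 s, S s & forall k, (k < n)%N -> s k = v k.

End FpsModule.

Section Submodules.
Variables (R : realDomainType) (V : lmodType (cplx R)).

Definition submodule (S : set V) : Prop :=
  S 0 /\ forall z u v, S u -> S v -> S (z *: u + v).

Definition lspan (S : set V) : set V :=
  [set v | exists r : seq (cplx R * V),
     (forall p, p \in r -> S p.2) /\ v = \sum_(p <- r) p.1 *: p.2].

Definition direct_sum (I : eqType) (S : I -> set V) : Prop :=
  [/\ forall i, submodule (S i),
      forall v, exists (r : seq I) (f : I -> V),
        [/\ uniq r, forall i, S i (f i) & v = \sum_(i <- r) f i] &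
      forall (r : seq I) (f : I -> V), uniq r -> (forall i, S i (f i)) ->
        \sum_(i <- r) f i = 0 -> forall i, i \in r -> f i = 0].

End Submodules.

Record directed (I : Type) (le : I -> I -> Prop) : Prop := Directed {
  dir_inhabited : inhabited I;
  dir_refl : forall a, le a a;
  dir_trans : forall a b c, le a b -> le b c -> le a c;
  dir_ub : forall a b, exists c, le a c /\ le b c }.

Record directed_exhaustion (R : realDomainType) (V : lmodType (cplx R)) (I : Type)
    (le : I -> I -> Prop) (T : set V) (S : I -> set V) : Prop := Exhaustion {
  exh_directed : directed le;
  exh_submodule : forall a, submodule (S a);
  exh_mono : forall a b, le a b -> (S a `<=` S b)%classic;
  exh_cover : forall v, T v <-> exists a, S a v }.

Definition antilinear (R : comNzRingType) (U V : lmodType (cplx R)) (f : U -> V) :=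
  forall z u v, f (z *: u + v) = conjc z *: f u + f v.

Record star_alg (R : realDomainType) (A : lmodType (cplx R)) := StarAlg {
  smul : A -> A -> A;
  star : A -> A;
  smulA : associative smul;
  smul_linl : forall b, linear (smul^~ b);
  smul_linr : forall a, linear (smul a);
  star_antilin : antilinear star;
  starK : involutive star;
  starM : forall a b, star (smul a b) = smul (star b) (star a) }.

Section Positivity.
Variables (R : realDomainType) (A : lmodType (cplx R)) (sA : star_alg A).

Definition pos_functional (w : {scalar A}) : Prop :=
  forall a, nonnegc (w (smul sA (star sA a) a)).

Definition pos_elt (a : A) : Prop :=
  star sA a = a /\ forall w : {scalar A}, pos_functional w -> nonnegc (w a).

Definition has_approx_identity : Prop :=
  exists (I : Type) (le : I -> I -> Prop) (S : I -> set A) (E : I -> A),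
  [/\ directed_exhaustion le setT S,
      forall a, star sA (E a) = E a,
      forall a b, le a b -> a <> b ->
        E a = smul sA (E a) (E b) /\ E a = smul sA (E b) (E a) &
      forall a x, S a x -> smul sA (E a) x = x /\ smul sA x (E a) = x].

Record deformation (dA : star_alg (fps A)) : Prop := Deformation {
  def_mul : exists m : nat -> A -> A -> A,
    [/\ forall r, (forall b, linear (m r ^~ b)) /\ (forall a, linear (m r a)),
        m 0%N = smul sA &
        forall (a b : fps A) n, smul dA a b n =
          \sum_(r < n.+1) \sum_(j < (n - r).+1) m r (a j) (b (n - r - j)%N)];
  def_star : exists I : nat -> A -> A,
    [/\ forall r, antilinear (I r), I 0%N = star sA &
        forall (a : fps A) n, star dA a n = \sum_(r < n.+1) I r (a (n - r)%N)] }.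

End Positivity.

Definition pos_deformation (R : realDomainType) (A : lmodType (cplx R))
    (sA : star_alg A) (dA : star_alg (fps A)) : Prop :=
  deformation sA dA /\
  forall w : {scalar A}, pos_functional sA w ->
    exists2 W : {scalar fps A}, pos_functional dA W &
      forall a, coefc (W (cst a)) 0 = w a.

Record pre_hilbert (R : realDomainType) (H : lmodType (cplx R)) := PreHilbert {
  hip : H -> H -> cplx R;
  hip_lin : forall x, scalar (hip x);
  hip_herm : forall x y, hip x y = conjc (hip y x);
  hip_ge0 : forall x, nonnegc (hip x x);
  hip_eq0 : forall x, hip x x = 0 -> x = 0 }.

(* [rep_adj] says that every [rep a] is adjointable and that its adjoint is
   [rep (star a)]. *)
Record star_rep (R : realDomainType) (A H : lmodType (cplx R)) (sA : star_alg A)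
    (hH : pre_hilbert H) := StarRep {
  rep :> A -> H -> H;
  rep_endo : forall a, linear (rep a);
  rep_lin : forall psi, linear (rep^~ psi);
  repM : forall a b psi, rep (smul sA a b) psi = rep a (rep b psi);
  rep_adj : forall a psi phi,
    hip hH psi (rep a phi) = hip hH (rep (star sA a) psi) phi }.

Section Tensor.
Variables (R : realDomainType) (A X H : lmodType (cplx R)).
Variables (act : X -> A -> X) (pi : A -> H -> H).

Definition balanced (M : lmodType (cplx R)) (b : X -> H -> M) : Prop :=
  [/\ forall x, linear (b x), forall psi, linear (b^~ psi) &
      forall x a psi, b (act x a) psi = b x (pi a psi)].

(* A sequence of pairs [(x, psi)] stands for the sum of the [x (x) psi]. *)
Definition tensor_eq : rel (seq (X * H)) := fun s t =>
  `[< forall (M : lmodType (cplx R)) (b : X -> H -> M), balanced b ->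
        \sum_(p <- s) b p.1 p.2 = \sum_(p <- t) b p.1 p.2 >].

Fact tensor_eq_refl : reflexive tensor_eq.
Proof. by move=> s; apply/asboolP. Qed.
Fact tensor_eq_sym : symmetric tensor_eq.
Proof. by move=> s t; apply/asboolP/asboolP => E M b /E ->. Qed.
Fact tensor_eq_trans : transitive tensor_eq.
Proof.
move=> t s u /asboolP st /asboolP tu; apply/asboolP => M b bb.
by rewrite st // tu.
Qed.
Canonical tensor_equiv :=
  EquivRel tensor_eq tensor_eq_refl tensor_eq_sym tensor_eq_trans.

Definition tensor := {eq_quot tensor_eq}.

Variables (hH : pre_hilbert H) (ip : X -> X -> A).

Definition tensor_presum (s t : seq (X * H)) : cplx R :=
  \sum_(p <- s) \sum_(q <- t) hip hH p.2 (pi (ip p.1 q.1) q.2).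

(* Independence of representatives is [tensor_formE] below. *)
Definition tensor_form (u v : tensor) : cplx R := tensor_presum (repr u) (repr v).

End Tensor.

(* A [bimod A B] carries the data of a (B-A)-bimodule with an [A]-valued inner
   product [ipr] and a [B]-valued inner product [ipl]. *)
Record bimod (R : realDomainType) (A B : lmodType (cplx R)) := Bimod {
  bcar :> lmodType (cplx R);
  lact : B -> bcar -> bcar;
  ract : bcar -> A -> bcar;
  ipr : bcar -> bcar -> A;
  ipl : bcar -> bcar -> B }.

Definition conj_mod (V : Type) := V.

Section ConjMod.
Variables (R : realDomainType) (V : lmodType (cplx R)).
HB.instance Definition _ := GRing.Zmodule.copy (conj_mod V) V.

Definition conj_scale (z : cplx R) (v : conj_mod V) : conj_mod V :=
  (conjc z *: (v : V) : V).

Fact conj_scaleA z w v : conj_scale z (conj_scale w v) = conj_scale (z * w) v.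
Proof. by rewrite /conj_scale scalerA conjcM. Qed.
Fact conj_scale1 : left_id 1 conj_scale.
Proof. by move=> v; rewrite /conj_scale conjc1 scale1r. Qed.
Fact conj_scaleDr : right_distributive conj_scale +%R.
Proof. by move=> z u v; rewrite /conj_scale scalerDr. Qed.
Fact conj_scaleDl v : {morph conj_scale^~ v : z w / z + w}.
Proof. by move=> z w; rewrite /conj_scale conjcD scalerDl. Qed.
HB.instance Definition _ := GRing.Zmodule_isLmodule.Build (cplx R) (conj_mod V)
  conj_scaleA conj_scale1 conj_scaleDr conj_scaleDl.
End ConjMod.

Section Bimodules.
Variables (R : realDomainType) (A B : lmodType (cplx R)).
Variables (sA : star_alg A) (sB : star_alg B).

Definition conj_bimod (X : bimod A B) : bimod B A :=
  @Bimod R B A (conj_mod X)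
    (fun a x => ract (x : X) (star sA a))
    (fun x b => lact (star sB b) (x : X))
    (fun x y => ipl (x : X) (y : X))
    (fun x y => ipr (x : X) (y : X)).

Variable X : bimod A B.
Implicit Types (x y z : X) (a : A) (b : B).

Record is_bimodule : Prop := IsBimodule {
  lact_linl : forall x, linear (fun b => lact b x);
  lact_linr : forall b, linear (fun x => lact b x);
  ract_linl : forall a, linear (fun x => ract x a);
  ract_linr : forall x, linear (fun a => ract x a);
  lactA : forall b b' x, lact (smul sB b b') x = lact b (lact b' x);
  ractA : forall x a a', ract x (smul sA a a') = ract (ract x a) a';
  lactC : forall b x a, ract (lact b x) a = lact b (ract x a) }.

Record condX1_5 : Prop := CondX1_5 {
  condX1 : forall x, linear (ipr x);
  condX2 : forall x y, ipr x y = star sA (ipr y x);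
  condX3 : forall x y a, ipr x (ract y a) = smul sA (ipr x y) a;
  condX4 : forall x, pos_elt sA (ipr x x);
  condX5 : forall x y b, ipr x (lact b y) = ipr (lact (star sB b) x) y }.

Record condY1_5 : Prop := CondY1_5 {
  condY1 : forall y, linear (fun x => ipl x y);
  condY2 : forall x y, ipl x y = star sB (ipl y x);
  condY3 : forall x y b, ipl (lact b x) y = smul sB b (ipl x y);
  condY4 : forall x, pos_elt sB (ipl x x);
  condY5 : forall x y a, ipl (ract x a) y = ipl x (ract y (star sA a)) }.

Definition condE3 : Prop := forall x y z, lact (ipl x y) z = ract x (ipr y z).

Definition condP : Prop :=
  forall (H : lmodType (cplx R)) (hH : pre_hilbert H) (pi : star_rep sA hH)
    (u : tensor (@ract _ _ _ X) pi),
  nonnegc (tensor_form hH (@ipr _ _ _ X) u u).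

Definition ipr_span : set A := lspan [set a | exists x y, a = ipr x y].
Definition ipl_span : set B := lspan [set b | exists x y, b = ipl x y].

Definition condX6 : Prop := forall a, ipr_span a.
Definition condY6 : Prop := forall b, ipl_span b.

End Bimodules.

Definition condQ (R : realDomainType) (A B : lmodType (cplx R))
    (sA : star_alg A) (sB : star_alg B) (X : bimod A B) : Prop :=
  condP sB (conj_bimod sA sB X).

Record equivalence_bimodule (R : realDomainType) (A B : lmodType (cplx R))
    (sA : star_alg A) (sB : star_alg B) (X : bimod A B) : Prop := EquivalenceBimodule {
  eb_bimodule : is_bimodule sA sB X;
  eb_X : condX1_5 sA sB X;
  eb_X6 : condX6 X;
  eb_Y : condY1_5 sA sB X;
  eb_Y6 : condY6 X;
  eb_E3 : condE3 X;
  eb_P : condP sA X;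
  eb_Q : condQ sA sB X }.

Record top_equivalence_bimodule (R : realDomainType) (A B : lmodType (cplx R))
    (dA : star_alg (fps A)) (dB : star_alg (fps B)) (X : bimod (fps A) (fps B)) : Prop :=
    TopEquivalenceBimodule {
  teb_bimodule : is_bimodule dA dB X;
  teb_X : condX1_5 dA dB X;
  teb_tX6 : adically_dense (ipr_span X);
  teb_Y : condY1_5 dA dB X;
  teb_tY6 : adically_dense (ipl_span X);
  teb_E3 : condE3 X;
  teb_P : condP dA X;
  teb_Q : condQ dA dB X }.

(* [act] is the right action for P1-P3 and the flipped left action for Q1-Q3. *)
Definition cyclic_decomposition (R : realDomainType) (X A V : lmodType (cplx R)) (act : X -> A -> X)
    (ip : X -> X -> V) : Prop :=
  exists (I : eqType) (S : I -> set X),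
  [/\ direct_sum S,
      forall i j, i != j -> forall x y, S i x -> S j y -> ip x y = 0,
      forall i x a, S i x -> S i (act x a) &
      forall i, exists (J : Type) (le : J -> J -> Prop) (T : J -> set X) (W : J -> X),
        [/\ directed_exhaustion le (S i) T,
            forall a, T a (W a) &
            forall a x, T a x -> exists c, x = act (W a) c]].

Definition condP1_3 (R : realDomainType) (A B : lmodType (cplx R)) (X : bimod A B) : Prop :=
  cyclic_decomposition (@ract _ _ _ X) (@ipr _ _ _ X).
Definition condQ1_3 (R : realDomainType) (A B : lmodType (cplx R)) (X : bimod A B) : Prop :=
  cyclic_decomposition (fun x b => lact b x) (@ipl _ _ _ X).

Section ClassicalLimit.
Variables (R : realDomainType) (A B : lmodType (cplx R)).
Variables (dA : star_alg (fps A)) (dB : star_alg (fps B)).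
Variables (X : bimod (fps A) (fps B)).

(* The submodule X_L; the proof argument makes it a [zmodClosed] predicate. *)
Definition nullset (hX : top_equivalence_bimodule dA dB X) : {pred X} :=
  fun x => `[< forall y : X, ipr x y 0%N = 0 >].

Variable hX : top_equivalence_bimodule dA dB X.
Implicit Types x y w : X.

Lemma nullsetP x : reflect (forall y, ipr x y 0%N = 0) (x \in nullset hX).
Proof. exact: asboolP. Qed.

Lemma ipr_linl (c : cplx (fps R)) x x' y :
  ipr (c *: x + x') y = conjc c *: ipr x y + ipr x' y.
Proof.
rewrite (condX2 (teb_X hX)) (condX1 (teb_X hX)) star_antilin.
by rewrite -!(condX2 (teb_X hX)).
Qed.

Lemma iprDl x x' y : ipr (x + x') y = ipr x y + ipr x' y.
Proof. by have := ipr_linl 1 x x' y; rewrite conjc1 !scale1r. Qed.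
Lemma ipr0l y : ipr (0 : X) y = 0.
Proof. by apply: (addrI (ipr (0 : X) y)); rewrite -iprDl !addr0. Qed.
Lemma iprZl c x y : ipr (c *: x) y = conjc c *: ipr x y.
Proof. by have := ipr_linl c x 0 y; rewrite ipr0l !addr0. Qed.
Lemma iprBl x x' y : ipr (x - x') y = ipr x y - ipr x' y.
Proof.
rewrite iprDl; congr (_ + _); apply: (addrI (ipr x' y)).
by rewrite -iprDl !subrr ipr0l.
Qed.

Fact nullset_closed : zmod_closed (nullset hX).
Proof.
split=> [|x y /nullsetP xN /nullsetP yN]; apply/nullsetP => w.
  by rewrite ipr0l.
by rewrite iprBl fpsB xN yN subrr.
Qed.
HB.instance Definition _ := GRing.isZmodClosed.Build X (nullset hX) nullset_closed.

Definition climit_mod := Quotient.quot (nullset hX).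

HB.instance Definition _ := GRing.Zmodule.on climit_mod.

Definition cl (x : X) : climit_mod := \pi x.

Lemma clP x y : cl x = cl y <-> forall w, ipr x w 0%N = ipr y w 0%N.
Proof.
have -> : (cl x = cl y) <-> (x - y \in nullset hX).
  by rewrite Quotient.idealrBE; split=> [/eqP|/eqP].
split=> [/nullsetP H w|H]; last by apply/nullsetP => w; rewrite iprBl fpsB H subrr.
by apply/eqP; rewrite -subr_eq0 -fpsB -iprBl H.
Qed.
Lemma cl_repr u : cl (repr u) = u. Proof. exact: reprK. Qed.
Lemma repr_cl x w : ipr (repr (cl x)) w 0%N = ipr x w 0%N.
Proof. by move: w; apply/clP; rewrite cl_repr. Qed.
Lemma clD x y : cl (x + y) = cl x + cl y.
Proof. exact: Quotient.pi_add. Qed.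
Lemma clN x : cl (- x) = - cl x.
Proof. exact: Quotient.pi_opp. Qed.
Lemma cl0 : cl 0 = 0.
Proof. by apply: (addrI (cl 0)); rewrite -clD !addr0. Qed.

Definition climit_scale (c : cplx R) (u : climit_mod) : climit_mod :=
  cl (cstc c *: repr u).

Lemma climit_scaleE c x : climit_scale (coefc c 0) (cl x) = cl (c *: x).
Proof.
apply/clP => w; rewrite !iprZl !fpsZ0 !coefc_conj coefc_cst /=.
by rewrite repr_cl.
Qed.
Lemma climit_scale_cst c x : climit_scale c (cl x) = cl (cstc c *: x).
Proof. by rewrite -climit_scaleE coefc_cst. Qed.

Fact climit_scaleA c d u : climit_scale c (climit_scale d u) = climit_scale (c * d) u.
Proof.
rewrite -[u]cl_repr !climit_scale_cst scalerA -!climit_scaleE coefcM !coefc_cst.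
by rewrite fpsM big_ord_recl big_ord0 addr0.
Qed.
Fact climit_scale1 : left_id 1 climit_scale.
Proof.
move=> u; rewrite -{2}[u]cl_repr -[cl (repr u)]/(cl _) -[repr u in RHS]scale1r.
by rewrite -climit_scaleE coefc1 cl_repr.
Qed.
Fact climit_scaleDr : right_distributive climit_scale +%R.
Proof.
move=> c u v; rewrite -[u]cl_repr -[v]cl_repr -clD !climit_scale_cst.
by rewrite scalerDr clD.
Qed.
Fact climit_scaleDl u : {morph climit_scale^~ u : c d / c + d}.
Proof.
move=> c d; rewrite -[u]cl_repr !climit_scale_cst -clD -scalerDl.
by rewrite -!climit_scaleE coefcD fpsD !coefc_cst.
Qed.
HB.instance Definition _ := GRing.Zmodule_isLmodule.Build (cplx R) climit_mod
  climit_scaleA climit_scale1 climit_scaleDr climit_scaleDl.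

(* The operations are computed on representatives; the lemmas [cl_lact], ...,
   [cl_ipl] below show that the class map intertwines them. *)
Definition climit : bimod A B :=
  @Bimod R A B climit_mod
    (fun b u => cl (lact (cst b) (repr u)))
    (fun u a => cl (ract (repr u) (cst a)))
    (fun u v => ipr (repr u) (repr v) 0%N)
    (fun u v => ipl (repr u) (repr v) 0%N).

Variables (sA : star_alg A) (sB : star_alg B).
Hypotheses (dfA : deformation sA dA) (dfB : deformation sB dB).
Hypotheses (aiA : has_approx_identity sA) (aiB : has_approx_identity sB).

Lemma clZ (c : cplx (fps R)) x : cl (c *: x) = coefc c 0 *: cl x.
Proof. by rewrite -climit_scaleE. Qed.

Lemma smul0 (V : lmodType (cplx R)) (sV : star_alg V) (dV : star_alg (fps V)) :
  deformation sV dV -> forall a b, smul dV a b 0%N = smul sV (a 0%N) (b 0%N).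
Proof.
by case=> -[m [_ <- E]] _ a b; rewrite E big_ord_recl big_ord0 addr0 big_ord_recl big_ord0 addr0.
Qed.
Lemma star0 (V : lmodType (cplx R)) (sV : star_alg V) (dV : star_alg (fps V)) :
  deformation sV dV -> forall a, star dV a 0%N = star sV (a 0%N).
Proof. by case=> _ [I [_ <- E]] a; rewrite E big_ord_recl big_ord0 addr0. Qed.

Lemma ipr_cl0 x x' y y' : cl x = cl x' -> cl y = cl y' ->
  ipr x y 0%N = ipr x' y' 0%N.
Proof.
move=> /clP -> /clP H.
by rewrite (condX2 (teb_X hX)) (star0 dfA) H -(star0 dfA) -(condX2 (teb_X hX)).
Qed.

Lemma cl_ipr x y : @ipr _ _ _ climit (cl x) (cl y) = ipr x y 0%N.
Proof. by apply: ipr_cl0; rewrite cl_repr. Qed.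

Lemma cl_lact b x : @lact _ _ _ climit b (cl x) = cl (lact (cst b) x).
Proof.
apply/clP => w; rewrite -[cst b](starK dB) -!(condX5 (teb_X hX)).
exact: repr_cl.
Qed.

Lemma cl_ract x a : @ract _ _ _ climit (cl x) a = cl (ract x (cst a)).
Proof.
apply/clP => w.
rewrite (condX2 (teb_X hX)) (condX3 (teb_X hX)) [RHS](congr1 (@^~ 0%N) (condX2 (teb_X hX) _ _)).
rewrite (condX3 (teb_X hX)) !(star0 dfA) !(smul0 dfA); congr (star _ (smul _ _ _)).
by apply: ipr_cl0; rewrite // cl_repr.
Qed.

Definition lambda : cplx (fps R) := Cplx ((fun n => (n == 1%N)%:R) : fps R) 0.

Lemma lambda_div (V : lmodType (cplx R)) (v : fps V) :
  v 0%N = 0 -> v = lambda *: ((fun n => v n.+1) : fps V).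
Proof.
move=> v0; apply: funext => -[|n]; first by rewrite v0 fpsZ0 scale0r.
rewrite fpsZ big_ord_recl [coefc _ _ in X in X + _](_ : _ = 0) ?scale0r ?add0r; last first.
  by apply: cplxP.
rewrite big_ord_recl /= [coefc _ _ in X in X + _](_ : _ = 1); last by apply: cplxP.
rewrite scale1r subSS subn0 big1 ?addr0 // => k _.
by rewrite [coefc _ _](_ : _ = 0) ?scale0r //; apply: cplxP.
Qed.

Lemma lambdaZ0 (V : lmodType (cplx R)) (v : fps V) : (lambda *: v) 0%N = 0.
Proof. by rewrite fpsZ0 [coefc _ _](_ : _ = 0) ?scale0r //; apply: cplxP. Qed.

Lemma linearDZ (S : pzRingType) (U V : lmodType S) (f : U -> V) : linear f ->
  [/\ f 0 = 0, forall u v, f (u + v) = f u + f v & forall c u, f (c *: u) = c *: f u].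
Proof.
move=> fL; have fD u v : f (u + v) = f u + f v by rewrite -[u]scale1r fL !scale1r.
have f0 : f 0 = 0 by apply: (addrI (f 0)); rewrite -fD !addr0.
by split=> // c u; rewrite -[c *: u]addr0 fL f0 addr0.
Qed.

Lemma lspan_annihil (V : lmodType (cplx R)) (W : set (fps V)) (g : V -> V) :
  linear g -> (forall b, W b -> g (b 0%N) = 0) ->
  adically_dense (lspan W) -> forall v, g v = 0.
Proof.
move=> /linearDZ [g0 gD gZ] gW dW v; have [s [r [rW ->]] sv] := dW (cst v) 1%N.
rewrite -[v]/(cst v 0%N) -sv // fps_sum.
elim: r rW {sv} => [|p r IH] rW; first by rewrite big_nil.
rewrite big_cons gD fpsZ0 gZ gW ?scaler0 ?add0r; last by apply: rW; rewrite mem_head.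
by apply: IH => q qr; apply: rW; rewrite in_cons qr orbT.
Qed.

Lemma nullset_ipl x : (x \in nullset hX) <-> (forall y, ipl x y 0%N = 0).
Proof.
have [[[hB hXc] hYc] hE] := (teb_bimodule hX, teb_X hX, teb_Y hX, teb_E3 hX).
have ipr0 z y : ipr z y 0%N = 0 <-> ipr y z 0%N = 0.
  have st0 : star sA 0 = 0.
    have := star_antilin sA 1 0 0; rewrite conjc1 !scale1r addr0 -{1}[star sA 0]addr0.
    by move/addrI.
  by split=> E; rewrite (condX2 hXc) (star0 dfA) E.
split=> [/nullsetP xN y|xN].
  have ann b : smul sB b (ipl x y 0%N) = 0.
    move: b; apply: (lspan_annihil (smul_linl sB _) _ (teb_tY6 hX)) => _ [w [z ->]].
    rewrite -(smul0 dfB) -(condY3 hYc) hE (lambda_div ((ipr0 _ _).1 (xN z))).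
    have [_ _ ->] := linearDZ (ract_linr hB w).
    by have [_ _ ->] := linearDZ (condY1 hYc y); rewrite lambdaZ0.
  have [I [le [S [E [exh _ _ SE]]]]] := aiB.
  have [a Sa] := (exh_cover exh (ipl x y 0%N)).1 Logic.I.
  by rewrite -(SE _ _ Sa).1 ann.
apply/nullsetP => y; apply/ipr0.
have ann a : smul sA (ipr y x 0%N) a = 0.
  move: a; apply: (lspan_annihil (smul_linr sA _) _ (teb_tX6 hX)) => _ [z [w ->]].
  rewrite -(smul0 dfA) -(condX3 hXc) -hE (lambda_div (xN z)).
  have [_ _ ->] := linearDZ (lact_linl hB w).
  by have [_ _ ->] := linearDZ (condX1 hXc y); rewrite lambdaZ0.
have [I [le [S [E [exh _ _ SE]]]]] := aiA.
have [a Sa] := (exh_cover exh (ipr y x 0%N)).1 Logic.I.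
by rewrite -(SE _ _ Sa).2 ann.
Qed.

Lemma cl_ipl x y : @ipl _ _ _ climit (cl x) (cl y) = ipl x y 0%N.
Proof.
have hYc := teb_Y hX.
have L z z' w : cl z = cl z' -> ipl z w 0%N = ipl z' w 0%N.
  move=> E; apply/eqP; rewrite -subr_eq0 -fpsB; apply/eqP.
  have [_ D Z] := linearDZ (condY1 hYc w).
  rewrite -scaleN1r -Z -D scaleN1r; apply: (nullset_ipl _).1.
  by rewrite Quotient.idealrBE; apply/eqP.
rewrite /= (L _ x) ?cl_repr // (condY2 hYc) (star0 dfB) (L _ y) ?cl_repr //.
by rewrite -(star0 dfB) -(condY2 hYc).
Qed.

End ClassicalLimit.

Lemma tensor_formE (R : realDomainType) (A B : lmodType (cplx R)) (sA : star_alg A)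
    (sB : star_alg B) (X : bimod A B) (H : lmodType (cplx R)) (hH : pre_hilbert H)
    (pi : star_rep sA hH) s t :
  condX1_5 sA sB X -> is_bimodule sA sB X ->
  tensor_form hH (@ipr _ _ _ X) (\pi_(tensor (@ract _ _ _ X) pi) s) (\pi t) =
  tensor_presum pi hH (@ipr _ _ _ X) s t.
Proof.
move=> cX bX.
have R1 (s' u v : seq (X * H)) : tensor_eq (@ract _ _ _ X) pi u v ->
    tensor_presum pi hH (@ipr _ _ _ X) s' u = tensor_presum pi hH (@ipr _ _ _ X) s' v.
  move=> /asboolP E; apply: eq_bigr => p _.
  apply: (E (cplx R)^o (fun x psi => hip hH p.2 (pi (ipr p.1 x) psi))); split.
  - move=> x c u' v'; rewrite rep_endo; exact: hip_lin.
  - move=> psi c u' v'; rewrite (condX1 cX) rep_lin; exact: hip_lin.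
  - by move=> x a psi; rewrite (condX3 cX) repM.
have herm (u v : seq (X * H)) : tensor_presum pi hH (@ipr _ _ _ X) u v =
    conjc (tensor_presum pi hH (@ipr _ _ _ X) v u).
  rewrite /tensor_presum (big_morph _ (@conjcD _) (@conjc0 _)) exchange_big /=.
  apply: eq_bigr => p _; rewrite (big_morph _ (@conjcD _) (@conjc0 _)).
  by apply: eq_bigr => q _; rewrite -hip_herm rep_adj -(condX2 cX).
have rE (u : seq (X * H)) :
    tensor_eq (@ract _ _ _ X) pi (repr (\pi_(tensor (@ract _ _ _ X) pi) u)) u.
  by apply/eqmodP; rewrite reprK.
rewrite /tensor_form (R1 _ _ _ (rE t)) herm (R1 _ _ _ (rE s)).
by rewrite -herm.
Qed.

(* Main.v *)
(* The algebraic axioms pass to the classical limit by comparing zeroth order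
   terms, since elements of [fps A] agreeing at order 0 differ by a multiple of
   lambda, which the class map kills; the spans become full because density is
   tested modulo lambda. Positivity X4 and Y4 is where positive deformations
   enter: a positive functional [w] of [A] lifts to some [W], and
   [w (a 0)] is the zeroth coefficient of [W a >= 0].

   P1-P3 imply P: orthogonality splits the tensor form into a sum over the
   summands [i], and by directedness the finitely many i-th components lie in one
   cyclic submodule, where the form is manifestly non-negative. Q is P for
   the conjugate bimodule, and P1-P3, Q1-Q3 are inherited by the classical limit. *)
Require Import Defs.
From HB Require Import structures.
From mathcomp Require Import all_boot all_order all_algebra.
From mathcomp Require Import boolp classical_sets.

Set Implicit Arguments.
Unset Strict Implicit.
Unset Printing Implicit Defensive.

Import GRing.Theory Num.Theory.
Local Open Scope ring_scope.

(** * Sums and spans under additive maps *)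

Lemma additive_sum (U V : zmodType) (f : U -> V) :
  (forall x y, f (x + y) = f x + f y) ->
  forall (I : Type) (r : seq I) (F : I -> U),
  f (\sum_(i <- r) F i) = \sum_(i <- r) f (F i).
Proof.
move=> fD I r F; apply: (big_morph f fD).
by apply: (addrI (f 0)); rewrite -fD !addr0.
Qed.

(** The map [f] is linear along the zeroth-coefficient map of scalars, so it carries linear
    combinations to linear combinations. With [f] the evaluation at order zero, this turns dense
    spans into full ones. *)
Lemma lspan_image (R : realDomainType) (V : lmodType (cplx (fps R)))
    (W : lmodType (cplx R)) (f : V -> W) (S : set V) (T : set W) v :
  (forall u w, f (u + w) = f u + f w) ->
  (forall c u, f (c *: u) = coefc c 0%N *: f u) ->
  (forall u, S u -> T (f u)) -> lspan S v -> lspan T (f v).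
Proof.
move=> fD fZ fS [r [rS ->]].
exists [seq (coefc p.1 0%N, f p.2) | p <- r]; split=> [p /mapP[q qr ->]|].
  exact/fS/rS.
rewrite (additive_sum fD) big_map.
by apply: eq_bigr => p _; rewrite fZ.
Qed.

(** * Positivity at order zero and vector functionals *)

Section Positivity.
Variable R : realDomainType.

Lemma nonnegc_sum (I : Type) (r : seq I) (F : I -> cplx R) :
  (forall i, nonnegc (F i)) -> nonnegc (\sum_(i <- r) F i).
Proof.
move=> F0; split; first by rewrite im_sum big1 // => i _; case: (F0 i).
by rewrite re_sum; apply: sumr_ge0 => i _; case: (F0 i).
Qed.

(** The lowest non-zero coefficient of a positive series is positive, and the zeroth coefficient is
    either that one or [0]. *)
Lemma nonnegc_coef0 (z : cplx (fps R)) : nonnegc z -> nonnegc (coefc z 0%N).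
Proof.
case: z => x y [/= -> x0]; split=> //=; move: x0.
rewrite Order.POrderTheory.le_eqVlt => /orP[/eqP <- //|/ltf0P[[|n] xn x0]].
  exact: Order.POrderTheory.ltW.
by rewrite x0.
Qed.

(** The series [a - cst (a 0)] is a multiple of [lambda], hence so is its image under [W]. *)
Lemma coefc_scalar_fps (A : lmodType (cplx R)) (W : {scalar fps A}) (a : fps A) :
  coefc (W a) 0%N = coefc (W (cst (a 0%N))) 0%N.
Proof.
have a0 : (a - cst (a 0%N)) 0%N = 0 by rewrite fpsB subrr.
rewrite -[a in LHS](subrK (cst (a 0%N))) (lambda_div a0) linearP coefcD fpsD.
by rewrite coefcM fpsM big_ord1 [coefc (lambda R) _](_ : _ = 0) ?mul0r ?add0r //; apply: cplxP.
Qed.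

Lemma pos_elt_coef0 (A : lmodType (cplx R)) (sA : star_alg A) (dA : star_alg (fps A))
    (a : fps A) :
  pos_deformation sA dA -> pos_elt dA a -> pos_elt sA (a 0%N).
Proof.
move=> [dfA posA] [aH a0]; split=> [|w w0].
  by rewrite -[in RHS]aH (star0 dfA).
have [W W0 WE] := posA w w0.
by rewrite -WE -coefc_scalar_fps; apply: nonnegc_coef0; apply: a0.
Qed.

Variables (A H : lmodType (cplx R)) (sA : star_alg A) (hH : pre_hilbert H).

(** Registered below as a [{scalar A}], so that [pos_elt] can be tested on it: this is how algebraic
    positivity reaches representations. *)
Definition vector_functional (pi : star_rep sA hH) (phi : H) (a : A) : cplx R :=
  hip hH phi (pi a phi).

Lemma vector_functional_scalar pi phi : scalar (vector_functional pi phi).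
Proof. by move=> c a b; rewrite /vector_functional rep_lin hip_lin. Qed.
HB.instance Definition _ pi phi := GRing.isLinear.Build (cplx R) A (cplx R) *%R
  (vector_functional pi phi) (vector_functional_scalar pi phi).

Lemma vector_functional_pos pi phi : pos_functional sA (vector_functional pi phi).
Proof.
move=> a; rewrite /= /vector_functional repM rep_adj starK; exact: hip_ge0.
Qed.

Lemma hipDr phi u v : hip hH phi (u + v) = hip hH phi u + hip hH phi v.
Proof. by have := hip_lin hH phi 1 u v; rewrite scale1r mul1r. Qed.

Lemma hipDl phi u v : hip hH (u + v) phi = hip hH u phi + hip hH v phi.
Proof. by rewrite hip_herm hipDr conjcD -!hip_herm. Qed.

Lemma repDr (pi : star_rep sA hH) a u v : pi a (u + v) = pi a u + pi a v.
Proof. by have [_ D _] := linearDZ (rep_endo pi a). Qed.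

Lemma repDl (pi : star_rep sA hH) a b u : pi (a + b) u = pi a u + pi b u.
Proof. by have [_ D _] := linearDZ (rep_lin pi u). Qed.

End Positivity.

(** * From cyclic decompositions to P and Q *)

Section CyclicDecomposition.
Variables (R : realDomainType) (A B : lmodType (cplx R)).
Variables (sA : star_alg A) (sB : star_alg B).

Lemma iprD_l (X : bimod A B) (x x' y : X) : condX1_5 sA sB X ->
  ipr (x + x') y = ipr x y + ipr x' y.
Proof.
move=> cX; rewrite (condX2 cX); have [_ -> _] := linearDZ (condX1 cX y).
rewrite -[ipr y x]scale1r star_antilin conjc1 scale1r.
by rewrite -!(condX2 cX).
Qed.

Lemma ipr_ract (X : bimod A B) (x y : X) a b : condX1_5 sA sB X ->
  ipr (ract x a) (ract y b) = smul sA (star sA a) (smul sA (ipr x y) b).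
Proof.
move=> cX; rewrite (condX3 cX) (condX2 cX) (condX3 cX) starM -(condX2 cX).
by rewrite smulA.
Qed.

(** Components are extended by zero off the support [r v], so that finitely many vectors can be
    expanded over one common index list [s]. *)
Lemma direct_sum_components (V : lmodType (cplx R)) (I : eqType) (S : I -> set V) :
  direct_sum S -> exists (r : V -> seq I) (F : I -> V -> V),
    (forall i v, S i (F i v)) /\
    (forall v s, uniq s -> {subset r v <= s} -> v = \sum_(i <- s) F i v).
Proof.
move=> [subS coverS _].
have [r /choice[f rf]] := choice coverS.
exists r, (fun i v => if i \in r v then f v i else 0); split=> [i v|v s us rs].
  by case: ifP => _; [case: (rf v) => _ + _; apply | case: (subS i)].
have [ur _ vE] := rf v.
rewrite -big_mkcond -big_filter {1}vE; apply: perm_big.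
apply: uniq_perm => //; first exact: filter_uniq.
by move=> i; rewrite mem_filter andb_idr //; apply: rs.
Qed.

(* On a cyclic submodule, [<W a, W b> = a^* <W, W> b], so the tensor form is
   evaluated by the vector functional of [sum_p pi(a_p) psi_p] at the positive
   element [<W, W>]. *)
Lemma cyclic_presum_ge0 (X : bimod A B) (H : lmodType (cplx R)) (hH : pre_hilbert H)
    (pi : star_rep sA hH) (w : X) (c : X * H -> A) (s : seq (X * H)) :
  condX1_5 sA sB X ->
  nonnegc (\sum_(p <- s) \sum_(q <- s)
    hip hH p.2 (pi (ipr (ract w (c p)) (ract w (c q))) q.2)).
Proof.
move=> cX; set phi := \sum_(p <- s) pi (c p) p.2.
suff -> : \sum_(p <- s) \sum_(q <- s)
    hip hH p.2 (pi (ipr (ract w (c p)) (ract w (c q))) q.2) =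
  vector_functional pi phi (ipr w w).
  by apply: (condX4 cX w).2; apply: vector_functional_pos.
rewrite /vector_functional {1}/phi.
rewrite (additive_sum (f := fun u => hip hH u (pi (ipr w w) phi))); last first.
  by move=> u v; rewrite hipDl.
apply: eq_bigr => p _; rewrite /phi.
rewrite (additive_sum (f := fun u => hip hH (pi (c p) p.2) (pi (ipr w w) u))); last first.
  by move=> u v; rewrite repDr hipDr.
apply: eq_bigr => q _.
by rewrite (ipr_ract _ _ _ _ cX) repM rep_adj starK repM.
Qed.

Lemma condP1_3_condP (X : bimod A B) :
  condX1_5 sA sB X -> condP1_3 X -> condP sA X.
Proof.
move=> cX [I [S [dS orthS _ cycS]]] H hH pi u.
rewrite /tensor_form /tensor_presum; move: (repr u) => s {u}.
have [r [F [FS FE]]] := direct_sum_components dS.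
(* One list of indices supporting all first components of [s]. *)
set t := undup (flatten [seq r p.1 | p <- s]).
have tE p : p \in s -> p.1 = \sum_(i <- t) F i p.1.
  move=> ps; apply: FE; first exact: undup_uniq.
  by move=> i ir; rewrite mem_undup; apply/flatten_mapP; exists p.
(* Orthogonality kills the mixed terms of the double expansion. *)
have iprF p q : p \in s -> q \in s ->
    ipr p.1 q.1 = \sum_(i <- t) ipr (F i p.1) (F i q.1).
  move=> ps qs; rewrite {1}(tE p ps).
  rewrite (additive_sum (f := fun x => ipr x q.1)); last by move=> *; apply: iprD_l.
  apply: eq_big_seq => i it; rewrite {1}(tE q qs).
  have [_ D _] := linearDZ (condX1 cX (F i p.1)).
  rewrite (additive_sum D) (bigD1_seq i) //= ?undup_uniq //.
  rewrite big1 ?addr0 // => j ji; apply: (orthS i j); rewrite // 1?eq_sym //.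
have -> : \sum_(p <- s) \sum_(q <- s) hip hH p.2 (pi (ipr p.1 q.1) q.2) =
    \sum_(i <- t) \sum_(p <- s) \sum_(q <- s)
      hip hH p.2 (pi (ipr (F i p.1) (F i q.1)) q.2).
  rewrite [RHS]exchange_big; apply: eq_big_seq => p ps.
  rewrite [RHS]exchange_big; apply: eq_big_seq => q qs.
  rewrite (iprF p q ps qs).
  by apply: (additive_sum (f := fun a => hip hH p.2 (pi a q.2))) => a b; rewrite repDl hipDr.
apply: nonnegc_sum => i.
have [J [le [T [W [[[J0 _ le_trans ub] _ Tmono Tcover] _ Tcyc]]]]] := cycS i.
(* Directedness gives an upper bound for the finitely many indices; for empty [s] any element of the
   inhabited [J] serves. *)
have [a Ta] : exists a, forall p, p \in s -> T a (F i p.1).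
  elim: (s) => [|p s' [a Ta]]; first by case: J0 => a; exists a.
  have [b Tb] := (Tcover (F i p.1)).1 (FS i p.1).
  have [d [ad bd]] := ub a b; exists d => q; rewrite in_cons => /orP[/eqP -> |qs].
    exact: Tmono bd _ Tb.
  by apply: Tmono ad _ _; apply: Ta.
(* The default [0] off [s] makes [c] a total function. *)
have /choice[c cE] : forall p, exists c, p \in s -> F i p.1 = ract (W a) c.
  move=> p; case: (boolP (p \in s)) => [ps|_]; last by exists 0.
  by have [c ->] := Tcyc a _ (Ta p ps); exists c.
rewrite (eq_big_seq (fun p => \sum_(q <- s)
    hip hH p.2 (pi (ipr (ract (W a) (c p)) (ract (W a) (c q))) q.2))).
  exact: cyclic_presum_ge0.
by move=> p ps; apply: eq_big_seq => q qs; rewrite !cE.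
Qed.

(** By Y1 and Y2, [ipl] is antilinear in its second argument; the conjugated scalars of [conj_mod]
    make it linear there. *)
Lemma condX1_5_conj (X : bimod A B) :
  condY1_5 sA sB X -> condX1_5 sB sA (conj_bimod sA sB X).
Proof.
move=> cY; split=> /=.
- move=> x c y z; rewrite (condY2 cY).
  have [_ D Z] := linearDZ (condY1 cY x).
  by rewrite D Z star_antilin conjcK -!(condY2 cY).
- by move=> x y; apply: (condY2 cY).
- move=> x y b; rewrite (condY2 cY) (condY3 cY) starM starK.
  by rewrite -(condY2 cY).
- by move=> x; apply: (condY4 cY).
- by move=> x y a; rewrite (condY5 cY) !starK.
Qed.

Lemma submodule_conj (V : lmodType (cplx R)) (S : set V) :
  submodule S -> submodule (S : set (conj_mod V)).
Proof. by move=> [S0 SL]; split=> // c u v; apply: SL. Qed.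

Lemma condP1_3_conj (X : bimod A B) :
  condQ1_3 X -> condP1_3 (conj_bimod sA sB X).
Proof.
move=> [I [S [[subS coverS indS] orthS actS cycS]]]; exists I, S; split=> //.
- by split=> // i; apply/submodule_conj/subS.
- by move=> i x b Sx; apply: actS.
- move=> i; have [J [le [T [W [[dir subT mono cov] TW cyc]]]]] := cycS i.
  exists J, le, T, W; split=> //.
    by split=> // a; apply/submodule_conj/subT.
  move=> a x Tx; have [b ->] := cyc a x Tx.
  (* In the conjugate bimodule [b] acts from the right as [star sB b] does from the left, so the two
     stars cancel. *)
  by exists (star sB b); rewrite /= starK.
Qed.

End CyclicDecomposition.

Lemma condQ1_3_condQ (R : realDomainType) (A B : lmodType (cplx R))
    (sA : star_alg A) (sB : star_alg B) (X : bimod A B) :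
  condY1_5 sA sB X -> condQ1_3 X -> condQ sA sB X.
Proof.
move=> cY qX; apply: (@condP1_3_condP R B A sB sA).
  exact: condX1_5_conj.
exact: condP1_3_conj.
Qed.

(** * Cyclic decompositions under the class map, for an abstract action and inner product so as to
    cover both P1-P3 and Q1-Q3 *)

Section PushForward.
Variables (R : realDomainType) (A V : lmodType (cplx R)).
Variables (X : lmodType (cplx (fps R))) (Y : lmodType (cplx R)).
Variables (act : X -> fps A -> X) (ip : X -> X -> fps V).
Variables (act' : Y -> A -> Y) (ip' : Y -> Y -> V) (f : X -> Y).
Hypothesis fD : forall x y, f (x + y) = f x + f y.
Hypothesis fZ : forall c x, f (c *: x) = coefc c 0%N *: f x.
Hypothesis f_surj : forall y, exists x, f x = y.
Hypothesis f_eq0 : forall x, f x = 0 <-> forall y, ip x y 0%N = 0.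
Hypothesis ipDl : forall x x' y, ip (x + x') y = ip x y + ip x' y.
Hypothesis ipDr : forall x y y', ip x (y + y') = ip x y + ip x y'.
Hypothesis f_act : forall x a, act' (f x) (a 0%N) = f (act x a).
Hypothesis f_ip : forall x y, ip' (f x) (f y) = ip x y 0%N.

Let f0 : f 0 = 0.
Proof. by apply: (addrI (f 0)); rewrite -fD !addr0. Qed.

Lemma submodule_push (S : set X) : submodule S -> submodule (f @` S)%classic.
Proof.
move=> [S0 SL]; split; first by exists 0.
move=> c _ _ [x Sx <-] [y Sy <-]; exists (cstc c *: x + y); first exact: SL.
by rewrite fD fZ coefc_cst.
Qed.

(* Directness survives in the quotient because the summands are orthogonal: if
   [sum_i x_i] is null then so is each [x_i], as [<x_i, y> = <sum_j x_j, y_i>]. *)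
Lemma direct_sum_push (I : eqType) (S : I -> set X) :
  direct_sum S ->
  (forall i j, i != j -> forall x y, S i x -> S j y -> ip x y = 0) ->
  direct_sum (fun i => f @` S i)%classic.
Proof.
move=> dS orthS; have [subS coverS _] := dS; split.
- by move=> i; apply: submodule_push.
- move=> v; have [x <-] := f_surj v; have [r [g [ur Sg ->]]] := coverS x.
  exists r, (fun i => f (g i)); split=> //; first by move=> i; exists (g i).
  exact: additive_sum.
move=> r g ur Sg g0 i ir.
have /choice[h hE] : forall i, exists x, S i x /\ f x = g i.
  by move=> j; have [x Sx xg] := Sg j; exists x.
rewrite -(hE i).2; apply/f_eq0 => y.
have [s [k [us Sk yE]]] := coverS y.
have ipk x j : S j x -> ip x y = if j \in s then ip x (k j) else 0.
  move=> Sx; rewrite yE (additive_sum (f := ip x)); last by move=> *; apply: ipDr.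
  case: ifP => js.
    rewrite (bigD1_seq j) //= big1 ?addr0 // => l lj.
    by apply: (orthS j l) => //; rewrite eq_sym.
  rewrite big_seq big1 // => l ls; apply: (orthS j l) => //.
  by apply: contraFneq js => ->.
rewrite (ipk _ _ (hE i).1); case: ifP => // _.
have <- : ip (\sum_(j <- r) h j) (k i) = ip (h i) (k i).
  rewrite (additive_sum (f := fun x => ip x (k i))); last by move=> *; apply: ipDl.
  rewrite (bigD1_seq i) //= big1 ?addr0 // => j ji.
  by apply: (orthS j i) => //; case: (hE j).
apply: (f_eq0 _).1; rewrite (additive_sum fD) -[RHS]g0.
by apply: eq_bigr => j _; case: (hE j).
Qed.

Lemma cyclic_decomposition_push :
  cyclic_decomposition act ip -> cyclic_decomposition act' ip'.
Proof.
move=> [I [S [dS orthS actS cycS]]].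
exists I, (fun i => f @` S i)%classic; split.
- exact: direct_sum_push.
- by move=> i j ij _ _ [x Sx <-] [y Sy <-]; rewrite f_ip (orthS i j).
- move=> i _ a [x Sx <-]; exists (act x (cst a)); first exact: actS.
  by rewrite -f_act.
move=> i; have [J [le [T [W [[dir subT mono cov] TW cyc]]]]] := cycS i.
exists J, le, (fun j => f @` T j)%classic, (fun j => f (W j)); split.
- split=> //.
  + by move=> j; apply: submodule_push.
  + by move=> j l jl _ [x Tx <-]; exists x => //; apply: mono jl _ Tx.
  + move=> v; split=> [[x Sx <-]|[j [x Tx <-]]].
      by have [j Tx] := (cov x).1 Sx; exists j, x.
    by exists x => //; apply/cov; exists j.
- by move=> j; exists (W j).
(* The generator of a cyclic piece is the class of the old one, and by [f_act] only the zeroth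
   coefficient of the series [c] acts on it. *)
by move=> j _ [x Tx <-]; have [c ->] := cyc j x Tx; exists (c 0%N); rewrite f_act.
Qed.

End PushForward.

(** * The equivalence bimodule axioms for the classical limit *)

Section ClassicalLimit.
Variables (R : realDomainType) (A B : lmodType (cplx R)).
Variables (sA : star_alg A) (sB : star_alg B).
Hypotheses (aiA : has_approx_identity sA) (aiB : has_approx_identity sB).
Variables (dA : star_alg (fps A)) (dB : star_alg (fps B)).
Hypotheses (pdA : pos_deformation sA dA) (pdB : pos_deformation sB dB).
Variables (X : bimod (fps A) (fps B)) (hX : top_equivalence_bimodule dA dB X).

Let dfA : deformation sA dA := proj1 pdA.
Let dfB : deformation sB dB := proj1 pdB.
Let cipr := cl_ipr hX dfA.
Let cipl := cl_ipl hX dfA dfB aiA aiB.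
Let hB := teb_bimodule hX.

Lemma cl_surj (u : climit hX) : exists x, cl hX x = u.
Proof. by exists (repr u); apply: cl_repr. Qed.

(** The difference [g a - g b] is a multiple of [lambda], and [clZ] turns the factor [lambda] into
    its zeroth coefficient [0]. *)
Lemma linear_cl_eq (V : lmodType (cplx R)) (g : fps V -> X) (a b : fps V) :
  linear g -> a 0%N = b 0%N -> cl hX (g a) = cl hX (g b).
Proof.
move=> /linearDZ[_ gD gZ] ab; have ab0 : (a - b) 0%N = 0 by rewrite fpsB ab subrr.
rewrite -[a](subrK b) gD clD (lambda_div ab0) gZ clZ.
by rewrite [coefc (lambda R) _](_ : _ = 0) ?scale0r ?add0r //; apply: cplxP.
Qed.

(** Extends [cl_ract] beyond constant series, since deformed products and adjoints of constants are
    in general not constant. *)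
Lemma cl_ract0 x (a : fps A) : ract (cl hX x : climit hX) (a 0%N) = cl hX (ract x a).
Proof.
rewrite (cl_ract hX dfA); apply: (linear_cl_eq (g := fun a : fps A => ract x a)) => //.
exact: ract_linr hB x.
Qed.

Lemma cl_lact0 (b : fps B) x : lact (b 0%N) (cl hX x : climit hX) = cl hX (lact b x).
Proof.
rewrite cl_lact; apply: (linear_cl_eq (g := fun b : fps B => lact b x)) => //.
exact: lact_linl hB x.
Qed.

Lemma cl_linear_cst c x y : c *: (cl hX x : climit hX) + cl hX y = cl hX (cstc c *: x + y).
Proof. by rewrite clD clZ coefc_cst. Qed.

Lemma climit_bimodule : is_bimodule sA sB (climit hX).
Proof.
split.
- move=> u; have [x <-] := cl_surj u => c b b'.
  by rewrite !cl_lact cl_linear_cst -(lact_linl hB) -cstZ -cstD.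
- move=> b c u v; have [[x <-] [y <-]] := (cl_surj u, cl_surj v).
  by rewrite cl_linear_cst !cl_lact cl_linear_cst (lact_linr hB).
- move=> a c u v; have [[x <-] [y <-]] := (cl_surj u, cl_surj v).
  by rewrite cl_linear_cst !(cl_ract hX dfA) cl_linear_cst (ract_linl hB).
- move=> u; have [x <-] := cl_surj u => c a a'.
  by rewrite !(cl_ract hX dfA) cl_linear_cst -(ract_linr hB) -cstZ -cstD.
- move=> b b' u; have [x <-] := cl_surj u.
  rewrite -[b]/(cst b 0%N) -[b']/(cst b' 0%N) -(smul0 dfB) !cl_lact0.
  by rewrite (lactA hB).
- move=> u a a'; have [x <-] := cl_surj u.
  rewrite -[a]/(cst a 0%N) -[a']/(cst a' 0%N) -(smul0 dfA) !cl_ract0.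
  by rewrite (ractA hB).
- move=> b u a; have [x <-] := cl_surj u.
  by rewrite (cl_ract hX dfA x) !cl_lact (cl_ract hX dfA) (lactC hB).
Qed.

Lemma climit_X1_5 : condX1_5 sA sB (climit hX).
Proof.
have hXc := teb_X hX; split.
- move=> u c v w; have [[[x <-] [y <-]] [z <-]] := (cl_surj u, cl_surj v, cl_surj w).
  rewrite cl_linear_cst !cipr (condX1 hXc) fpsD fpsZ0.
  by rewrite coefc_cst.
- move=> u v; have [[x <-] [y <-]] := (cl_surj u, cl_surj v).
  by rewrite !cipr -(star0 dfA) -(condX2 hXc).
- move=> u v a; have [[x <-] [y <-]] := (cl_surj u, cl_surj v).
  by rewrite (cl_ract hX dfA) !cipr (condX3 hXc) (smul0 dfA).
- move=> u; have [x <-] := cl_surj u.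
  rewrite cipr; exact: pos_elt_coef0 pdA (condX4 hXc x).
- move=> u v b; have [[x <-] [y <-]] := (cl_surj u, cl_surj v).
  rewrite -[b]/(cst b 0%N) -(star0 dfB) !cl_lact0 !cipr.
  by rewrite (condX5 hXc).
Qed.

Lemma climit_Y1_5 : condY1_5 sA sB (climit hX).
Proof.
have hYc := teb_Y hX; split.
- move=> u c v w; have [[[x <-] [y <-]] [z <-]] := (cl_surj u, cl_surj v, cl_surj w).
  rewrite cl_linear_cst !cipl (condY1 hYc) fpsD fpsZ0.
  by rewrite coefc_cst.
- move=> u v; have [[x <-] [y <-]] := (cl_surj u, cl_surj v).
  by rewrite !cipl -(star0 dfB) -(condY2 hYc).
- move=> u v b; have [[x <-] [y <-]] := (cl_surj u, cl_surj v).
  by rewrite cl_lact !cipl (condY3 hYc) (smul0 dfB).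
- move=> u; have [x <-] := cl_surj u.
  rewrite cipl; exact: pos_elt_coef0 pdB (condY4 hYc x).
- move=> u v a; have [[x <-] [y <-]] := (cl_surj u, cl_surj v).
  rewrite -[a]/(cst a 0%N) -(star0 dfA) !cl_ract0 !cipl.
  by rewrite (condY5 hYc).
Qed.

Lemma climit_E3 : condE3 (climit hX).
Proof.
move=> u v w; have [[[x <-] [y <-]] [z <-]] := (cl_surj u, cl_surj v, cl_surj w).
by rewrite cipl cipr cl_lact0 cl_ract0 (teb_E3 hX).
Qed.

Lemma climit_X6 : condX6 (climit hX).
Proof.
(* Precision [1] means agreement at order zero, which is all that the limit sees. *)
move=> a; have [s ss sE] := teb_tX6 hX (cst a) 1%N.
rewrite -[a]/(cst a 0%N) -sE //.
apply: (lspan_image (f := fun v : fps A => v 0%N) _ _ _ ss) => //.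
  by move=> *; apply: fpsZ0.
by move=> _ [x [y ->]]; exists (cl hX x), (cl hX y); rewrite cipr.
Qed.

Lemma climit_Y6 : condY6 (climit hX).
Proof.
move=> b; have [s ss sE] := teb_tY6 hX (cst b) 1%N.
rewrite -[b]/(cst b 0%N) -sE //.
apply: (lspan_image (f := fun v : fps B => v 0%N) _ _ _ ss) => //.
  by move=> *; apply: fpsZ0.
by move=> _ [x [y ->]]; exists (cl hX x), (cl hX y); rewrite cipl.
Qed.

Lemma climit_equivalence : condP sA (climit hX) -> condQ sA sB (climit hX) ->
  equivalence_bimodule sA sB (climit hX).
Proof.
move=> cP cQ; split=> //; [exact: climit_bimodule | exact: climit_X1_5 |
  exact: climit_X6 | exact: climit_Y1_5 | exact: climit_Y6 | exact: climit_E3].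
Qed.

(** * Inheritance of P1-P3 and Q1-Q3 *)

Lemma cl_eq0 x : cl hX x = 0 <-> forall y, ipr x y 0%N = 0.
Proof.
rewrite -(cl0 hX); split=> [/clP E y|E]; first by rewrite E (ipr0l hX).
by apply/clP => y; rewrite E (ipr0l hX).
Qed.

Lemma climit_P1_3 : condP1_3 X -> condP1_3 (climit hX).
Proof.
apply: (cyclic_decomposition_push (f := cl hX)).
- exact: clD.
- exact: clZ.
- exact: cl_surj.
- exact: cl_eq0.
- by move=> *; apply: iprD_l (teb_X hX).
- by move=> x; have [] := linearDZ (condX1 (teb_X hX) x).
- exact: cl_ract0.
- exact: cipr.
Qed.

Lemma climit_Q1_3 : condQ1_3 X -> condQ1_3 (climit hX).
Proof.
have iplDl (y x x' : X) : ipl (x + x') y = ipl x y + ipl x' y.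
  by have [_ D _] := linearDZ (condY1 (teb_Y hX) y).
have cY := condX1_5_conj (teb_Y hX).
apply: (cyclic_decomposition_push (f := cl hX)).
- exact: clD.
- exact: clZ.
- exact: cl_surj.
(* Null vectors are defined through [ipr]; [nullset_ipl], which rests on the approximate identities,
   identifies them with those of [ipl]. *)
- move=> x; rewrite cl_eq0; split=> [E|E].
    apply: (nullset_ipl hX dfA dfB aiA aiB x).1; exact/nullsetP.
  by apply/(nullsetP hX); apply: (nullset_ipl hX dfA dfB aiA aiB x).2.
- by move=> *; apply: iplDl.
(* Additivity of [ipl] in its second argument is read off the conjugate bimodule, whose addition is
   the same. *)
- by move=> x; have [] := linearDZ (condX1 cY x).
- by move=> x b; apply: cl_lact0.
- exact: cipl.
Qed.

End ClassicalLimit.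

Theorem theorem9p7 (R : realDomainType) (A B : lmodType (cplx R))
    (sA : star_alg A) (sB : star_alg B)
    (aiA : has_approx_identity sA) (aiB : has_approx_identity sB)
    (dA : star_alg (fps A)) (dB : star_alg (fps B))
    (pdA : pos_deformation sA dA) (pdB : pos_deformation sB dB)
    (X : bimod (fps A) (fps B)) (hX : top_equivalence_bimodule dA dB X) :
  (condP sA (climit hX) -> condQ sA sB (climit hX) ->
     equivalence_bimodule sA sB (climit hX)) /\
  (condP1_3 X -> condQ1_3 X ->
     [/\ equivalence_bimodule sA sB (climit hX),
         condP1_3 (climit hX) & condQ1_3 (climit hX)]).
Proof.
have [[eqv cX] cY] := (climit_equivalence aiA aiB pdA pdB (hX := hX),
  climit_X1_5 pdA pdB hX, climit_Y1_5 aiA aiB pdA pdB hX).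
split=> // pX qX.
(* The decompositions are moved to the limit first; P and Q are then derived there from its own
   positivity conditions X4 and Y4. *)
have [pL qL] := (climit_P1_3 pdA hX pX, climit_Q1_3 aiA aiB pdA pdB hX qX).
split=> //; apply: eqv; first exact: condP1_3_condP cX pL.
exact: condQ1_3_condQ cY qL.
Qed.
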